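(* Let $0<|q|<1$, let $a,b,c,d,e,f,g,h$ be nonzero complex parameters with $a^3q^2=bcdefgh$, and suppose the series $\phi=\phi(a;b,c,d,e,f,g,h)$ defined in the context is terminating (i.e. one of $b,c,d,e,f,g,h$, say $h$, equals $q^{-n}$ with $n\in\{0,1,2,\dots\}$); assume no denominator below (including those in the series) vanishes. Then $$\frac{g(1-h)\left(1-\frac ah\right)\left(1-\frac{aq}{h}\right)\left(1-\frac{aq}{gb}\right)\left(1-\frac{aq}{gc}\right)\left(1-\frac{aq}{gd}\right)\left(1-\frac{aq}{ge}\right)\left(1-\frac{aq}{gf}\right)}{1-\frac{hq}{g}}\,\bigl[\phi(g-,h+)-\phi\bigr]$$ $$-\frac{h(1-g)\left(1-\frac ag\right)\left(1-\frac{aq}{g}\right)\left(1-\frac{aq}{hb}\right)\left(1-\frac{aq}{hc}\right)\left(1-\frac{aq}{hd}\right)\left(1-\frac{aq}{he}\right)\left(1-\frac{aq}{hf}\right)}{1-\frac{gq}{h}}\,\bigl[\phi(h-,g+)-\phi\bigr]$$ $$-\frac{aq}{h}\left(1-\frac hg\right)\left(1-\frac{gh}{aq}\right)(1-b)(1-c)(1-d)(1-e)(1-f)\,\phi=0 .$$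
   Context: Notation: $(x)_k=\prod_{j=0}^{k-1}(1-xq^j)$. The series is the very well poised balanced $$\phi(a;b,c,d,e,f,g,h)={}_{10}\phi_9\left(\begin{matrix}a,\,q\sqrt a,\,-q\sqrt a,\,b,c,d,e,f,g,h\\ \sqrt a,-\sqrt a,\frac{aq}{b},\frac{aq}{c},\frac{aq}{d},\frac{aq}{e},\frac{aq}{f},\frac{aq}{g},\frac{aq}{h}\end{matrix};q,q\right)=\sum_{k\ge0}\frac{1-aq^{2k}}{1-a}\,\frac{(a)_k}{(q)_k}\prod_{x\in\{b,c,d,e,f,g,h\}}\frac{(x)_k}{(aq/x)_k}\;q^k ,$$ where the product runs over the seven listed parameters. $\phi(g-,h+)$ is $\phi$ with $g,h$ replaced by $g/q,\,hq$, and $\phi(h-,g+)$ is $\phi$ with $h,g$ replaced by $h/q,\,gq$ (other parameters unchanged). *)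

(* Defs.v *)
From mathcomp Require Import all_boot all_order all_algebra.
From mathcomp Require Import complex.
From mathcomp Require Import all_classical all_reals all_analysis.

Set Implicit Arguments.
Unset Strict Implicit.
Unset Printing Implicit Defensive.

Import Order.TTheory GRing.Theory Num.Theory.
Import numFieldNormedType.Exports.

Local Open Scope ring_scope.
Local Open Scope complex_scope.

Section VeryWellPoised.
Variable R : realType.
Implicit Types (q a x : R[i]) (s : seq R[i]).

Definition qpoch q x (k : nat) : R[i] := \prod_(j < k) (1 - x * q ^+ j).

(* After simplification of the factors involving +/- sqrt a and
   +/- q * sqrt a, which contribute (1 - a * q ^+ (2 * k)) / (1 - a); hence no
   square root of a has to be chosen. *)
Definition vwp_term q a s (k : nat) : R[i] :=
  (1 - a * q ^+ (2 * k)) / (1 - a) * (qpoch q a k / qpoch q q k)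
  * (\prod_(x <- s) (qpoch q x k / qpoch q (a * q / x) k)) * q ^+ k.

Definition vwp_denoms_neq0 q a s : Prop :=
  1 - a != 0 /\
  forall k : nat,
    qpoch q q k != 0 /\ (forall x, x \in s -> qpoch q (a * q / x) k != 0).

(* The sum over all k >= 0, as the limit of the partial sums; R[i]^o is R[i] with
   the topology given by its modulus. *)
Definition phi109 q (a b c d e f g h : R[i]) : R[i] :=
  limn (series (vwp_term q a [:: b; c; d; e; f; g; h] : nat -> R[i]^o)).

End VeryWellPoised.

(* Main.v *)
Require Import Defs.
From mathcomp Require Import all_boot all_order all_algebra.
From mathcomp Require Import complex.
From mathcomp Require Import all_classical all_reals all_analysis.
From mathcomp Require Import ring.

Import Order.TTheory GRing.Theory Num.Theory.
Import numFieldNormedType.Exports.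

Local Open Scope ring_scope.
Local Open Scope complex_scope.

(* Put X = q^k. Term by term, (1-h)(1-a/h) [phi(g-,h+) - phi] acquires the
   factor (1-X)(1-aX), since (1-hX)(1-aX/h) and (1-gX/q)(1-aqX/g) are affine in
   aX+1/X up to the factor X. Hence the k-th term of the left-hand side is the
   term of phi times P(X) / [(1-gX/q)(1-hX/q)(1-aqX/g)(1-aqX/h)], where P(X)/X^2
   is quadratic in aX+1/X. With
     A = (1-aX)(1-gX/q)(1-hX/q) prod(1-xX),
     B = (1-X)(1-aqX/g)(1-aqX/h) prod(1-aX/x)     (x = b,c,d,e,f),
   the balancing condition makes X^-4 (A-B) odd under X -> 1/(aX), and X(1-aX^2)P
   is a constant multiple of A-B; this makes the sum telescope. The partial sums
   then contain (b)_n(c)_n(d)_n(e)_n(f)_n(g)_{n-1}(h)_{n-1}, which vanishes for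
   large n. *)

(** Balancing is solved for [b], leaving an identity of rational functions in independent variables.
    The values [r (a * q / g)], [r (a * q / h)] and [p 1] are the five-fold products in the three
    coefficients of the relation. *)
Lemma telescoping_kernel (F : fieldType) (a q b c d e f g h X : F) :
  q != 0 -> a != 0 -> c != 0 -> d != 0 -> e != 0 -> f != 0 ->
  g != 0 -> h != 0 -> b = a ^+ 3 * q ^+ 2 / (c * d * e * f * g * h) ->
  let p y := (1 - b * y) * (1 - c * y) * (1 - d * y) * (1 - e * y) * (1 - f * y) in
  let r y := (1 - y / b) * (1 - y / c) * (1 - y / d) * (1 - y / e) * (1 - y / f) in
  X * (1 - a * X ^+ 2) *
   (- (g ^+ 2 / q) * (1 - a * q / (g * h)) * (1 - a * q / h) * r (a * q / g) *
      ((1 - X) * (1 - a * X) * (1 - h * X / q) * (1 - a * q * X / h))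
    + (h ^+ 2 / q) * (1 - a * q / (g * h)) * (1 - a * q / g) * r (a * q / h) *
      ((1 - X) * (1 - a * X) * (1 - g * X / q) * (1 - a * q * X / g))
    - a * q / h * (1 - h / g) * (1 - g * h / (a * q)) * p 1 *
      ((1 - g * X / q) * (1 - h * X / q) *
       (1 - a * q * X / g) * (1 - a * q * X / h)))
  = g * (1 - a * q / (g * h)) * (1 - a * q / h) * (1 - a * q / g) * (1 - h / g) *
    ((1 - a * X) * p X * (1 - g * X / q) * (1 - h * X / q)
     - (1 - X) * r (a * X) * (1 - a * q * X / g) * (1 - a * q * X / h)).
Proof.
move=> q0 a0 c0 d0 e0 f0 g0 h0 -> p r; rewrite /p /r.
field.
by rewrite q0 a0 c0 d0 e0 f0 g0 h0.
Qed.

Section ContiguousRelation.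
Variable R : realType.
Implicit Types (q a x y z : R[i]) (s : seq R[i]).

(** * Shifted factorials and terminating sums *)

Lemma qpoch0 q x : qpoch q x 0 = 1.
Proof. exact: big_ord0. Qed.

Lemma qpochSr q x n : qpoch q x n.+1 = qpoch q x n * (1 - x * q ^+ n).
Proof. exact: big_ord_recr. Qed.

Lemma qpochS q x n : qpoch q x n.+1 = (1 - x) * qpoch q (x * q) n.
Proof.
rewrite /qpoch big_ord_recl expr0 mulr1; congr (_ * _).
by apply: eq_bigr => i _; rewrite lift0 exprS mulrA.
Qed.

Lemma qpoch_eq0 q m n : q != 0 -> (m < n)%N -> qpoch q (q ^- m) n = 0.
Proof.
move=> q0 ltmn; rewrite /qpoch (bigD1 (Ordinal ltmn)) //=.
by rewrite mulVf ?expf_neq0// subrr mul0r.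
Qed.

Lemma vwp_term_eq0 q a s m n : q != 0 -> q ^- m \in s -> (m < n)%N ->
  vwp_term q a s n = 0.
Proof.
move=> q0 ms ltmn; rewrite /vwp_term (big_rem _ ms) /=.
by rewrite qpoch_eq0// !mul0r mulr0 mul0r.
Qed.

Lemma limn_series_finite (u : nat -> R[i]^o) N :
  (forall k, (N <= k)%N -> u k = 0) ->
  limn (series u) = \sum_(0 <= k < N) u k.
Proof.
move=> u0; apply: (@lim_near_cst R[i]^o) => //.
exists N => // n /= leNn; rewrite /series /=.
rewrite (big_cat_nat _ leNn) //= [X in _ + X]big_nat [X in _ + X]big1 ?addr0//.
by move=> k /andP[/u0].
Qed.

(** * The terms of the three series over a common kernel *)

(** Collects the factors untouched by the shifts, which move only the last two parameters. *)
Definition vwp_base q a s n : R[i] :=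
  qpoch q a n / qpoch q q n * \prod_(x <- s) (qpoch q x n / qpoch q (a * q / x) n).

Lemma vwp_term_cat2 q a s y z n :
  vwp_term q a (s ++ [:: y; z]) n =
  (1 - a * (q ^+ n) ^+ 2) / (1 - a) * q ^+ n * vwp_base q a s n
  * (qpoch q y n / qpoch q (a * q / y) n * (qpoch q z n / qpoch q (a * q / z) n)).
Proof.
rewrite /vwp_term /vwp_base big_cat /= !big_cons big_nil mulr1.
by rewrite -exprM (mulnC n); ring.
Qed.

(* Indexed by n = k-1: (g)_{k-1} is (g)_k / (1-gX/q) without the junk value
   when gX = q, a case that does occur for terminating series. *)
Definition vwp_kernel q a s g h n : R[i] :=
  vwp_base q a s n.+1 * (qpoch q g n * qpoch q h n
    / (qpoch q (a * q / g) n.+2 * qpoch q (a * q / h) n.+2)).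

Lemma vwp_kernelC q a s g h n : vwp_kernel q a s g h n = vwp_kernel q a s h g n.
Proof.
by rewrite /vwp_kernel (mulrC (qpoch q g n)) (mulrC (qpoch q (a * q / g) _)).
Qed.

Lemma vwp_termE q a s g h n : q != 0 ->
  qpoch q (a * q / g) n.+2 != 0 -> qpoch q (a * q / h) n.+2 != 0 ->
  let X := q ^+ n.+1 in
  vwp_term q a (s ++ [:: g; h]) n.+1 =
  vwp_kernel q a s g h n * (X * (1 - a * X ^+ 2) / (1 - a)) *
  ((1 - g * X / q) * (1 - h * X / q) *
   (1 - a * q * X / g) * (1 - a * q * X / h)).
Proof.
move=> q0 + + X; rewrite vwp_term_cat2 -/X /vwp_kernel.
rewrite ![qpoch q (_ / _) n.+2]qpochSr !mulf_eq0 !negb_or -/X.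
move=> /andP[g1 g2] /andP[h1 h2].
rewrite (qpochSr q g) (qpochSr q h).
have -> : q ^+ n = X / q by rewrite /X exprSr mulfK.
have -> : a * q * X / g = a * q / g * X by ring.
have -> : a * q * X / h = a * q / h * X by ring.
move: (vwp_base _ _ _ _) (a * q / g) (a * q / h) g1 g2 h1 h2 => K u v.
move: (qpoch _ _ _) (qpoch _ _ _) (qpoch _ _ _) (qpoch _ _ _) => P G Q H.
move: (1 - u * X) (1 - v * X) (1 - a)^-1 => x y z Q0 x0 H0 y0.
by field; rewrite q0 x0 Q0 H0 y0.
Qed.

(** Brings nonvanishing hypotheses into the denominator-free form of the side conditions of
    [field]. *)
Lemma sub_neq0_div y z : z != 0 -> 1 - y / z != 0 -> z - y != 0.
Proof. by move=> z0; apply: contraNneq => /subr0_eq <-; rewrite divff ?subrr. Qed.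

(** Besides the kernel, both terms share (1-hX/q)(1-aqX/h). What remains is
    (1-g/q)(1-aq/g)(1-hX)(1-aX/h) - (1-h)(1-a/h)(1-gX/q)(1-aqX/g), a quadratic in X that vanishes at
    X = 1 and X = 1/a; its value at X = 0 is the constant (h-g/q)(1-aq/(gh)). *)
Lemma vwp_term_shift_diff q a s g h n : q != 0 -> g != 0 -> h != 0 ->
  qpoch q (a * q / g) n.+2 != 0 -> qpoch q (a * q / h) n.+2 != 0 ->
  qpoch q (a / h) n.+1 != 0 ->
  let X := q ^+ n.+1 in
  (1 - h) * (1 - a / h) *
    (vwp_term q a (s ++ [:: g / q; h * q]) n.+1 -
     vwp_term q a (s ++ [:: g; h]) n.+1) =
  vwp_kernel q a s g h n * (X * (1 - a * X ^+ 2) / (1 - a)) *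
  ((h - g / q) * (1 - a * q / (g * h))) *
  ((1 - X) * (1 - a * X) * (1 - h * X / q) * (1 - a * q * X / h)).
Proof.
move=> q0 g0 h0 Ag0 Ah0 ah0 X.
rewrite mulrBr (@vwp_termE q a s g h n) // -/X.
have qn : q ^+ n = X / q by rewrite /X exprSr mulfK.
have hqE : (1 - h) * qpoch q (h * q) n.+1 =
    qpoch q h n * (1 - h * X / q) * (1 - h * X).
  by rewrite -qpochS !qpochSr qn -/X mulrA.
have gqE : qpoch q (g / q) n.+1 = (1 - g / q) * qpoch q g n.
  by rewrite qpochS divfK.
have AgE : qpoch q (a * q / g) n.+2 = (1 - a * q / g) * qpoch q (a * q / (g / q)) n.+1.
  by rewrite qpochS; congr (_ * qpoch _ _ _); field; rewrite q0 g0.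
have AhE : qpoch q (a * q / (h * q)) n.+1 = (1 - a / h) * qpoch q (a * q / h) n.
  have -> : a * q / (h * q) = a / h by field; rewrite q0 h0.
  by rewrite qpochS mulrAC.
have ah1 : 1 - a / h != 0 by move: ah0; rewrite qpochS mulf_eq0 negb_or => /andP[].
move: Ag0 Ah0; rewrite /vwp_kernel AgE !(qpochSr q (a * q / h)) qn -/X.
rewrite !mulf_eq0 !negb_or => /andP[g1 G0] /andP[/andP[H0 h1] h2].
rewrite vwp_term_cat2 -/X gqE AhE.
(* The factor [1 - a / h] of the denominator cancels the prefactor, and [1 - h] moves next to
   (hq)_{n+1}, where [hqE] applies. *)
have -> K P Q W : (1 - h) * (1 - a / h) *
   (K * (P / Q * (qpoch q (h * q) n.+1 / ((1 - a / h) * W)))) =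
   K * (P / Q * ((1 - h) * qpoch q (h * q) n.+1 / W)).
  rewrite invfM; move: (1 - a / h) (qpoch _ _ _) ah1 => t z t0.
  transitivity (t / t * (K * (P / Q * ((1 - h) * z / W)))); first by ring.
  by rewrite divff // mul1r.
rewrite hqE.
have {g1}g1 : g - a * q != 0 by exact: sub_neq0_div.
have {h1}h1 : h - a * X != 0.
  apply: sub_neq0_div => //; move: h1.
  by rewrite [_ * (X / q)](_ : _ = a * X / h) //; field; rewrite q0 h0.
have {h2}h2 : h - a * q * X != 0.
  by apply: sub_neq0_div => //; rewrite mulrAC.
move: (qpoch _ _ _) (qpoch _ _ _) (qpoch _ _ _) (qpoch _ _ _) (vwp_base _ _ _ _) (1 - a)^-1 G0 H0.
move=> P Q U V K c Q0 V0.
by field; rewrite h0 q0 g0 h2 h1 V0 Q0 g1.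
Qed.

(** * The telescoping certificate *)

(* The sum of the terms 0..n of the left-hand side, up to a constant factor. *)
Definition vwp_cert q a s g h n : R[i] :=
  qpoch q a n.+1 / qpoch q q n
  * \prod_(x <- s) (qpoch q x n.+1 / qpoch q (a * q / x) n)
  * (qpoch q g n * qpoch q h n
     / (qpoch q (a * q / g) n.+1 * qpoch q (a * q / h) n.+1)).

(** Over the kernel of index n, the certificate at n has cofactor B and, by [vwp_certS], the one at
    n+1 has cofactor A. Here the denominators of the kernel are longer than those of the
    certificate, so their extra factors must be nonzero to cancel. *)
Lemma vwp_certE q a s g h n : q != 0 -> qpoch q q n.+1 != 0 ->
  qpoch q (a * q / g) n.+2 != 0 -> qpoch q (a * q / h) n.+2 != 0 ->
  (forall x, x \in s -> qpoch q (a * q / x) n.+1 != 0) ->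
  let X := q ^+ n.+1 in
  vwp_cert q a s g h n = vwp_kernel q a s g h n *
    ((1 - X) * \prod_(x <- s) (1 - a * X / x)
     * (1 - a * q * X / g) * (1 - a * q * X / h)).
Proof.
move=> q0 qq gg hh ss X; rewrite /vwp_cert /vwp_kernel /vwp_base.
have -> : \prod_(x <- s) (qpoch q x n.+1 / qpoch q (a * q / x) n) =
    \prod_(x <- s) (qpoch q x n.+1 / qpoch q (a * q / x) n.+1) *
    \prod_(x <- s) (1 - a * X / x).
  rewrite -big_split /= !big_seq; apply: eq_bigr => x /ss.
  have -> : a * X / x = a * q / x * q ^+ n by rewrite /X exprS; ring.
  rewrite qpochSr mulf_eq0 negb_or => /andP[P0 x0].
  by rewrite invfM mulrA divfK.
have -> : a * q * X / g = a * q / g * X by ring.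
have -> : a * q * X / h = a * q / h * X by ring.
move: qq gg hh; rewrite (qpochSr q q) -exprS -/X.
rewrite (qpochSr q (a * q / g) n.+1) (qpochSr q (a * q / h) n.+1) -/X.
rewrite !mulf_eq0 !negb_or => /andP[Q0 q1] /andP[G0 g1] /andP[H0 h1].
move: (1 - X) (1 - a * q / g * X) (1 - a * q / h * X) q1 g1 h1 => x y z x0 y0 z0.
by field; rewrite Q0 x0 G0 y0 H0 z0.
Qed.

Lemma vwp_certS q a s g h n : q != 0 ->
  let X := q ^+ n.+1 in
  vwp_cert q a s g h n.+1 = vwp_kernel q a s g h n *
    ((1 - a * X) * \prod_(x <- s) (1 - x * X)
     * (1 - g * X / q) * (1 - h * X / q)).
Proof.
move=> q0 X; rewrite /vwp_cert /vwp_kernel /vwp_base.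
have -> : \prod_(x <- s) (qpoch q x n.+2 / qpoch q (a * q / x) n.+1) =
    \prod_(x <- s) (qpoch q x n.+1 / qpoch q (a * q / x) n.+1) *
    \prod_(x <- s) (1 - x * X).
  by rewrite -big_split /=; apply: eq_bigr => x _; rewrite qpochSr mulrAC.
rewrite (qpochSr q a n.+1) (qpochSr q g) (qpochSr q h) -/X.
have -> : q ^+ n = X / q by rewrite /X exprSr mulfK.
by ring.
Qed.

Lemma vwp_term_swap q a s y z n :
  vwp_term q a (s ++ [:: y; z]) n = vwp_term q a (s ++ [:: z; y]) n.
Proof. by rewrite !vwp_term_cat2 [_ / _ * (_ / _)]mulrC. Qed.

(** Since h - g/q = -(g/q)(1 - hq/g), and likewise with g and h exchanged, the denominators in the
    coefficients cancel and the combination becomes the left-hand side of [telescoping_kernel]. *)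
Lemma vwp_term_telescope q a b c d e f g h n :
  q != 0 -> a != 0 -> b != 0 -> c != 0 -> d != 0 -> e != 0 -> f != 0 ->
  g != 0 -> h != 0 -> a ^+ 3 * q ^+ 2 = b * c * d * e * f * g * h ->
  qpoch q q n.+1 != 0 ->
  (forall x k, x \in [:: b; c; d; e; f; g; h] -> qpoch q (a * q / x) k != 0) ->
  qpoch q (a / g) n.+1 != 0 -> qpoch q (a / h) n.+1 != 0 ->
  1 - h * q / g != 0 -> 1 - g * q / h != 0 ->
  let s := [:: b; c; d; e; f] in
  let T y z := vwp_term q a (s ++ [:: y; z]) n.+1 in
  g * (1 - h) * (1 - a / h) * (1 - a * q / h)
    * (1 - a * q / (g * b)) * (1 - a * q / (g * c)) * (1 - a * q / (g * d))
    * (1 - a * q / (g * e)) * (1 - a * q / (g * f))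
    / (1 - h * q / g) * (T (g / q) (h * q) - T g h)
  - h * (1 - g) * (1 - a / g) * (1 - a * q / g)
    * (1 - a * q / (h * b)) * (1 - a * q / (h * c)) * (1 - a * q / (h * d))
    * (1 - a * q / (h * e)) * (1 - a * q / (h * f))
    / (1 - g * q / h) * (T (g * q) (h / q) - T g h)
  - a * q / h * (1 - h / g) * (1 - g * h / (a * q))
    * (1 - b) * (1 - c) * (1 - d) * (1 - e) * (1 - f) * T g h
  = g * (1 - a * q / (g * h)) * (1 - a * q / h) * (1 - a * q / g) * (1 - h / g)
    / (1 - a) * (vwp_cert q a s g h n.+1 - vwp_cert q a s g h n).
Proof.
move=> q0 a0 b0 c0 d0 e0 f0 g0 h0 bal qq den ag ah hg gh s T.
have Dg : qpoch q (a * q / g) n.+2 != 0 by rewrite den// !inE eqxx !orbT.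
have Dh : qpoch q (a * q / h) n.+2 != 0 by rewrite den// !inE eqxx !orbT.
have bE : b = a ^+ 3 * q ^+ 2 / (c * d * e * f * g * h).
  by rewrite bal; field; rewrite c0 d0 e0 f0 g0 h0.
pose X := q ^+ n.+1; pose K := vwp_kernel q a s g h n.
have E1 := @vwp_term_shift_diff q a s g h n q0 g0 h0 Dg Dh ah.
have E2 := @vwp_term_shift_diff q a s h g n q0 h0 g0 Dh Dg ag.
have E3 := @vwp_termE q a s g h n q0 Dg Dh.
rewrite vwp_certS// vwp_certE//; last first.
  by move=> x xs; apply: den; rewrite -[[:: b; _; _; _; _; _; _]]/(s ++ [:: g; h]) mem_cat xs.
have KE := @telescoping_kernel _ a q b c d e f g h X q0 a0 c0 d0 e0 f0 g0 h0 bE.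
move: E1 E2 E3 KE; rewrite /= -/X -/K vwp_kernelC -/K.
rewrite !(vwp_term_swap q a s h) (vwp_term_swap q a s (h / q)) -/(T _ _).
rewrite -/(T (g / q) (h * q)) -/(T g h) -/(T (g * q) (h / q)) /s !big_cons !big_nil.
move=> E1 E2 E3 KE.
have dE y z : a * q / y / z = a * q / (y * z) by rewrite invfM mulrA.
rewrite !dE !(mulrC h g) in E2 KE *.
set A := (X in X * (T (g / q) (h * q) - T g h)).
set B := (X in X * (T (g * q) (h / q) - T g h)).
(* [A'] and [B'] leave out exactly the factors that [E1] and [E2] absorb. *)
pose A' := g * (1 - a * q / h)
    * (1 - a * q / (g * b)) * (1 - a * q / (g * c)) * (1 - a * q / (g * d))
    * (1 - a * q / (g * e)) * (1 - a * q / (g * f)) / (1 - h * q / g).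
pose B' := h * (1 - a * q / g)
    * (1 - a * q / (h * b)) * (1 - a * q / (h * c)) * (1 - a * q / (h * d))
    * (1 - a * q / (h * e)) * (1 - a * q / (h * f)) / (1 - g * q / h).
have -> : A = A' * ((1 - h) * (1 - a / h)) by rewrite /A /A'; ring.
have -> : B = B' * ((1 - g) * (1 - a / g)) by rewrite /B /B'; ring.
rewrite -(mulrA A') E1 -(mulrA B') E2 E3 /A' /B' {A B A' B'}.
(* The right-hand side of [KE] is a constant times the difference of the two certificate cofactors,
   so [KE] is used multiplied by K / (1 - a). *)
lazymatch type of KE with _ = ?y => transitivity (K / (1 - a) * y) end; last by ring.
rewrite -KE {E1 E2 E3 KE}.
move: (1 - a * q / (g * b)) (1 - a * q / (g * c)) (1 - a * q / (g * d)).
move: (1 - a * q / (g * e)) (1 - a * q / (g * f)) (1 - a * q / (h * b)).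
move: (1 - a * q / (h * c)) (1 - a * q / (h * d)) (1 - a * q / (h * e)).
move: (1 - a * q / (h * f)) (1 - a)^-1 K X => z1 y K X z2 z3 z4 z5 z6 z7 z8 z9 z10.
field.
by rewrite h0 g0 q0 a0 (sub_neq0_div _ _ h0 gh) (sub_neq0_div _ _ g0 hg).
Qed.

Lemma vwp_term0 q a s : 1 - a != 0 -> vwp_term q a s 0 = 1.
Proof.
move=> a1; rewrite /vwp_term muln0 expr0 mulr1 divff // !qpoch0 divr1 !mul1r mulr1.
by apply: big1 => x _; rewrite !qpoch0 divr1.
Qed.

Lemma vwp_partial_sum q a b c d e f g h n :
  q != 0 -> a != 0 -> b != 0 -> c != 0 -> d != 0 -> e != 0 -> f != 0 ->
  g != 0 -> h != 0 -> a ^+ 3 * q ^+ 2 = b * c * d * e * f * g * h ->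
  1 - a != 0 -> (forall k, qpoch q q k != 0) ->
  (forall x k, x \in [:: b; c; d; e; f; g; h] -> qpoch q (a * q / x) k != 0) ->
  (forall k, qpoch q (a / g) k != 0) -> (forall k, qpoch q (a / h) k != 0) ->
  1 - h * q / g != 0 -> 1 - g * q / h != 0 ->
  let s := [:: b; c; d; e; f] in
  let S y z := \sum_(0 <= k < n.+1) vwp_term q a (s ++ [:: y; z]) k in
  g * (1 - h) * (1 - a / h) * (1 - a * q / h)
    * (1 - a * q / (g * b)) * (1 - a * q / (g * c)) * (1 - a * q / (g * d))
    * (1 - a * q / (g * e)) * (1 - a * q / (g * f))
    / (1 - h * q / g) * (S (g / q) (h * q) - S g h)
  - h * (1 - g) * (1 - a / g) * (1 - a * q / g)
    * (1 - a * q / (h * b)) * (1 - a * q / (h * c)) * (1 - a * q / (h * d))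
    * (1 - a * q / (h * e)) * (1 - a * q / (h * f))
    / (1 - g * q / h) * (S (g * q) (h / q) - S g h)
  - a * q / h * (1 - h / g) * (1 - g * h / (a * q))
    * (1 - b) * (1 - c) * (1 - d) * (1 - e) * (1 - f) * S g h
  = g * (1 - a * q / (g * h)) * (1 - a * q / h) * (1 - a * q / g) * (1 - h / g)
    / (1 - a) * vwp_cert q a s g h n.
Proof.
move=> q0 a0 b0 c0 d0 e0 f0 g0 h0 bal a1 qq den ag ah hg gh s S.
rewrite /S {S}; elim: n => [|n IHn].
  (* All terms of index 0 are 1, so only the last summand survives; it matches because
     -(aq/h)(1-gh/(aq)) = g(1-aq/(gh)). *)
  rewrite !big_nat1 !vwp_term0 // !subrr !mulr0 subrr sub0r mulr1.
  rewrite /vwp_cert /s !big_cons big_nil !qpochSr !qpoch0 !mul1r !expr0 !mulr1 !divr1.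
  have Dg : qpoch q (a * q / g) 1 != 0 by rewrite den// !inE eqxx !orbT.
  have Dh : qpoch q (a * q / h) 1 != 0 by rewrite den// !inE eqxx !orbT.
  move: Dg Dh; rewrite !qpochSr !qpoch0 !mul1r !expr0 !mulr1 => Dg Dh.
  by field; rewrite a0 q0 g0 h0 a1 (sub_neq0_div _ _ g0 Dg) (sub_neq0_div _ _ h0 Dh).
have step := @vwp_term_telescope q a b c d e f g h n q0 a0 b0 c0 d0 e0 f0 g0 h0
  bal (qq _) den (ag _) (ah _) hg gh.
rewrite /= -/s in step; rewrite -[vwp_cert _ _ _ _ _ _.+1](subrK (vwp_cert q a s g h n)).
rewrite [RHS]mulrDr -IHn -step {IHn step}.
rewrite ![\sum_(0 <= k < n.+2) _]big_nat_recr //=.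
move: (_ / (1 - h * q / g)) (_ / (1 - g * q / h)) => A B.
by ring.
Qed.


(** * From partial sums to the terminating series *)

Lemma phi109_terminating q a b c d e f g h m n :
  q != 0 -> q ^- m \in [:: b; c; d; e; f; g; h] -> (m < n)%N ->
  phi109 q a b c d e f g h =
  \sum_(0 <= k < n) vwp_term q a ([:: b; c; d; e; f] ++ [:: g; h]) k.
Proof.
move=> q0 ms ltmn; apply: limn_series_finite => k /(leq_trans ltmn).
exact: vwp_term_eq0.
Qed.

(* If [h = q ^- 0], the contiguous series need not terminate, but then the
   factor [1 - h] vanishes. *)
Lemma phi109_shift_terminating q a b c d e f g h m n :
  q != 0 -> q ^- m \in [:: b; c; d; e; f; g; h] -> (m.+1 < n)%N ->
  (1 - h) * phi109 q a b c d e f (g / q) (h * q) =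
  (1 - h) * \sum_(0 <= k < n) vwp_term q a
    ([:: b; c; d; e; f] ++ [:: g / q; h * q]) k.
Proof.
move=> q0 ms ltmn.
have [->|h1] := eqVneq h 1; first by rewrite subrr !mul0r.
(* The exponent is m for an unshifted parameter, m+1 if g = q^-m, and m-1 if h = q^-m, where h != 1
   excludes m = 0. *)
have [k lekm ks] : exists2 k, (k <= m.+1)%N &
    q ^- k \in [:: b; c; d; e; f; g / q; h * q].
  have [ms5|] := boolP (q ^- m \in [:: b; c; d; e; f]).
    exists m => //; rewrite -[[:: b, c & _]]/([:: b; c; d; e; f] ++ [:: g / q; h * q]).
    by rewrite mem_cat ms5.
  move: ms; rewrite -[[:: b, c & _]]/([:: b; c; d; e; f] ++ [:: g; h]) mem_cat.
  move=> /orP[->//|+ _]; rewrite !inE => /orP[] /eqP mE.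
    exists m.+1 => //; rewrite -mE exprSr invfM mulrC.
    by rewrite !inE eqxx !orbT.
  case: m mE {ltmn} => [|m] mE; first by rewrite -mE expr0 invr1 eqxx in h1.
  exists m; first by rewrite ltnW.
  by rewrite -mE exprS invfM mulrAC mulVf// mul1r !inE eqxx !orbT.
by rewrite (phi109_terminating _ _ _ _ _ _ _ _ _ _ n q0 ks (leq_ltn_trans lekm ltmn)).
Qed.

Lemma phi109_swap q a b c d e f g h :
  phi109 q a b c d e f g h = phi109 q a b c d e f h g.
Proof.
rewrite /phi109; have -> // : vwp_term q a [:: b; c; d; e; f; g; h] =
  vwp_term q a [:: b; c; d; e; f; h; g].
by apply/funext => n; exact: (vwp_term_swap q a [:: b; c; d; e; f]).
Qed.

(** The strict bound is dictated by (g)_n and (h)_n, which are one factor shorter than (x)_{n+1} for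
    the other parameters. *)
Lemma vwp_cert_eq0 q a b c d e f g h m n : q != 0 ->
  q ^- m \in [:: b; c; d; e; f; g; h] -> (m < n)%N ->
  vwp_cert q a [:: b; c; d; e; f] g h n = 0.
Proof.
move=> q0 + ltmn; rewrite -[[:: b, c & _]]/([:: b; c; d; e; f] ++ [:: g; h]) mem_cat.
rewrite /vwp_cert => /orP[ms|].
  by rewrite (big_rem _ ms) /= qpoch_eq0 ?ltnS 1?ltnW// !mul0r mulr0 mul0r.
by rewrite !inE => /orP[] /eqP <-; rewrite qpoch_eq0// ?(mulr0, mul0r).
Qed.

End ContiguousRelation.

Theorem theorem3 (R : realType) (q a b c d e f g h : R[i])
  (q_gt0 : 0 < `|q|) (q_lt1 : `|q| < 1)
  (a_neq0 : a != 0) (b_neq0 : b != 0) (c_neq0 : c != 0) (d_neq0 : d != 0)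
  (e_neq0 : e != 0) (f_neq0 : f != 0) (g_neq0 : g != 0) (h_neq0 : h != 0)
  (balanced : a ^+ 3 * q ^+ 2 = b * c * d * e * f * g * h)
  (terminating : exists n : nat, q ^- n \in [:: b; c; d; e; f; g; h])
  (den_phi : vwp_denoms_neq0 q a [:: b; c; d; e; f; g; h])
  (den_phi_gm_hp : vwp_denoms_neq0 q a [:: b; c; d; e; f; g / q; h * q])
  (den_phi_hm_gp : vwp_denoms_neq0 q a [:: b; c; d; e; f; g * q; h / q])
  (den_hg : 1 - h * q / g != 0) (den_gh : 1 - g * q / h != 0) :
  let phi := phi109 q a b c d e f g h in
  let phi_gm_hp := phi109 q a b c d e f (g / q) (h * q) in
  let phi_hm_gp := phi109 q a b c d e f (g * q) (h / q) in
  g * (1 - h) * (1 - a / h) * (1 - a * q / h)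
    * (1 - a * q / (g * b)) * (1 - a * q / (g * c)) * (1 - a * q / (g * d))
    * (1 - a * q / (g * e)) * (1 - a * q / (g * f))
    / (1 - h * q / g) * (phi_gm_hp - phi)
  - h * (1 - g) * (1 - a / g) * (1 - a * q / g)
    * (1 - a * q / (h * b)) * (1 - a * q / (h * c)) * (1 - a * q / (h * d))
    * (1 - a * q / (h * e)) * (1 - a * q / (h * f))
    / (1 - g * q / h) * (phi_hm_gp - phi)
  - a * q / h * (1 - h / g) * (1 - g * h / (a * q))
    * (1 - b) * (1 - c) * (1 - d) * (1 - e) * (1 - f) * phi
  = 0.
Proof.
have q0 : q != 0 by rewrite -normr_gt0.
move=> phi phi_gm_hp phi_hm_gp.
have [n nq] := terminating.
have [a1 den] := den_phi.
have qq k : qpoch q q k != 0 by case: (den k).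
have ax x k : x \in [:: b; c; d; e; f; g; h] -> qpoch q (a * q / x) k != 0.
  by case: (den k) => _; apply.
(* In the shifted series the parameter hq has the denominator (aq/(hq))_k = (a/h)_k. *)
have ah k : qpoch q (a / h) k != 0.
  have [_ /(_ k)[_ /(_ (h * q))]] := den_phi_gm_hp.
  by rewrite -mulf_div divff // mulr1; apply; rewrite !inE eqxx !orbT.
have ag k : qpoch q (a / g) k != 0.
  have [_ /(_ k)[_ /(_ (g * q))]] := den_phi_hm_gp.
  by rewrite -mulf_div divff // mulr1; apply; rewrite !inE eqxx !orbT.
have nq' : q ^- n \in [:: b; c; d; e; f; h; g].
  by move: nq; rewrite !inE; do 5!case: eqP => //= _; rewrite orbC.
(* Summing up to n+1 rather than n leaves room for g/q or h/q to equal q^-(n+1), and makes the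
   certificate vanish. *)
have := @vwp_partial_sum R q a b c d e f g h n.+1 q0 a_neq0 b_neq0 c_neq0 d_neq0
  e_neq0 f_neq0 g_neq0 h_neq0 balanced a1 qq ax ag ah den_hg den_gh.
rewrite /= (vwp_cert_eq0 _ _ _ _ _ _ _ _ _ _ n) // mulr0.
have -> : \sum_(0 <= k < n.+2) vwp_term q a [:: b; c; d; e; f; g; h] k = phi.
  by rewrite /phi (@phi109_terminating _ _ _ _ _ _ _ _ _ _ n n.+2) // ltnW.
have := @phi109_shift_terminating R q a b c d e f g h n n.+2 q0 nq (ltnSn _).
have := @phi109_shift_terminating R q a b c d e f h g n n.+2 q0 nq' (ltnSn _).
rewrite phi109_swap -/phi_gm_hp -/phi_hm_gp.
rewrite (eq_bigr _ (fun k _ => vwp_term_swap _ _ _ _ _ _ k)) /=.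
move: (\sum_(0 <= k < n.+2) _) (\sum_(0 <= k < n.+2) _) => S2 S1 E2 E1 <-.
(* [E1] and [E2] know the shifted series only up to the factors [1 - h] and [1 - g], which therefore
   have to enter the brackets. *)
have reorder u v w x1 x2 x3 x4 x5 x6 y x z :
    u * v * w * x1 * x2 * x3 * x4 * x5 * x6 * y * (x - z) =
    u * w * x1 * x2 * x3 * x4 * x5 * x6 * y * (v * x - v * z) :> R[i].
  by ring.
by rewrite 2!reorder E1 E2 -2!reorder.
Qed.
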